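(* Let $S_1$ and $S_2$ be two isometries such that $S_1S_1^*+S_2S_2^*=1$, and let $\sigma$ be the unique order two automorphism of $\mathcal{O}_2=C^*(S_1,S_2)$ such that $\sigma(S_1)=S_2$. Then the C*-crossed-product $\mathcal{O}_2\rtimes_\sigma\mathbb{Z}_2$ is *-isomorphic to $\mathcal{O}_2$.
   Context: The Cuntz algebra $\mathcal{O}_2$ is the universal unital C*-algebra generated by two isometries $S_1,S_2$ with $S_1S_1^*+S_2S_2^*=1$. It is simple, and for any two isometries satisfying this relation on a nonzero Hilbert space, the C*-algebra $C^*(S_1,S_2)$ they generate is (canonically) $\mathcal{O}_2$. By universality there is a unique *-automorphism $\sigma$ of $\mathcal{O}_2$ with $\sigma(S_1)=S_2$ and $\sigma(S_2)=S_1$; it satisfies $\sigma^2=\mathrm{id}$, so it defines an action of $\mathbb{Z}_2=\mathbb{Z}/2\mathbb{Z}$. The C*-crossed-product $\mathcal{O}_2\rtimes_\sigma\mathbb{Z}_2$ is the universal C*-algebra generated by two isometries $S_1,S_2$ with $S_1S_1^*+S_2S_2^*=1$ and a unitary $w$ such that $w^2=1$ and $wS_1=S_2w$. *)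

(* Defs.v *)
From HB Require Import structures.
From mathcomp Require Import all_boot all_order all_algebra.
From mathcomp Require Import complex.
From mathcomp Require Import all_classical all_reals all_analysis.

Set Implicit Arguments.
Unset Strict Implicit.
Unset Printing Implicit Defensive.

Import Order.TTheory GRing.Theory Num.Theory.
Import numFieldNormedType.Exports.
Import Normc.

Local Open Scope classical_set_scope.
Local Open Scope ring_scope.
Local Open Scope complex_scope.

(* Unital C*-algebras over the complex numbers [R[i]].  The norm is a field of
   this structure, and completeness is spelled out: MathComp's only join of
   rings and normed modules is [numDomainType], whose norm is multiplicative,
   so [algType] and [completeNormedModType] cannot be combined.  The zero
   algebra is excluded, since [algType] requires [1 != 0]. *)
HB.mixin Record isCStarAlgebra (R : realType) A of GRing.Algebra R[i] A := {
  star : A -> A;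
  starK : involutive star;
  starD : {morph star : x y / x + y};
  starZ : forall (c : R[i]) (x : A), star (c *: x) = c^* *: star x;
  starM : forall x y : A, star (x * y) = star y * star x;
  cnorm : A -> R;
  cnorm0_eq0 : forall x : A, cnorm x = 0 -> x = 0;
  cnormD : forall x y : A, cnorm (x + y) <= cnorm x + cnorm y;
  cnormZ : forall (c : R[i]) (x : A), cnorm (c *: x) = normc c * cnorm x;
  cnormM : forall x y : A, cnorm (x * y) <= cnorm x * cnorm y;
  cnorm_starM : forall x : A, cnorm (star x * x) = cnorm x ^+ 2;
  cnorm_complete : forall x_ : nat -> A,
    (forall e : R, 0 < e -> exists N : nat, forall m n : nat,
       (N <= m)%N -> (N <= n)%N -> cnorm (x_ m - x_ n) < e) ->
    exists l : A, cnorm (x_ n - l) @[n --> \oo] --> (0 : R)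
}.

#[short(type="cstarAlgType")]
HB.structure Definition CStarAlgebra (R : realType) :=
  {A of isCStarAlgebra R A & GRing.Algebra R[i] A}.

(* Unital *-homomorphisms.  No continuity is required: between C*-algebras it
   is automatic. *)
Definition star_hom (R : realType) (A B : cstarAlgType R) (f : A -> B) : Prop :=
  [/\ linear f, monoid_morphism f & {morph f : x / star x}].

Definition star_isomorphic (R : realType) (A B : cstarAlgType R) : Prop :=
  exists f : A -> B, star_hom f /\ bijective f.

Definition isometry_elt (R : realType) (A : cstarAlgType R) (s : A) : Prop :=
  star s * s = 1.

Definition unitary_elt (R : realType) (A : cstarAlgType R) (u : A) : Prop :=
  star u * u = 1 /\ u * star u = 1.

Definition cuntz_pair (R : realType) (A : cstarAlgType R) (s1 s2 : A) : Prop :=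
  [/\ isometry_elt s1, isometry_elt s2 & s1 * star s1 + s2 * star s2 = 1].

(* [A], with generators [s1] and [s2], is the Cuntz algebra O_2: the universal
   unital C*-algebra generated by a pair of isometries with
   s1 s1^* + s2 s2^* = 1. *)
Definition is_cuntz_algebra (R : realType) (A : cstarAlgType R) (s1 s2 : A) :
    Prop :=
  cuntz_pair s1 s2 /\
  forall (D : cstarAlgType R) (t1 t2 : D), cuntz_pair t1 t2 ->
    exists! f : A -> D, [/\ star_hom f, f s1 = t1 & f s2 = t2].

(* An action of Z/2Z on [A] is given by the automorphism by which the
   generator acts. *)
Definition order_two_automorphism (R : realType) (A : cstarAlgType R)
    (sigma : A -> A) : Prop :=
  [/\ star_hom sigma, involutive sigma & sigma <> id].

(* Covariant representations of (A, Z/2Z, sigma) in [D]; the unitary [u] is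
   the image of the generator of Z/2Z. *)
Definition covariant_pair (R : realType) (A D : cstarAlgType R)
    (sigma : A -> A) (pi : A -> D) (u : D) : Prop :=
  [/\ star_hom pi, unitary_elt u, u ^+ 2 = 1 &
      forall a : A, u * pi a * star u = pi (sigma a)].

(* [B], with the canonical homomorphism [iota : A -> B] and the canonical
   unitary [w], is the C*-crossed-product of [A] by the action of Z/2Z
   generated by [sigma]. *)
Definition is_crossed_product_Z2 (R : realType) (A : cstarAlgType R)
    (sigma : A -> A) (B : cstarAlgType R) (iota : A -> B) (w : B) : Prop :=
  covariant_pair sigma iota w /\
  forall (D : cstarAlgType R) (pi : A -> D) (u : D), covariant_pair sigma pi u ->
    exists! f : B -> D,
      [/\ star_hom f, forall a : A, f (iota a) = pi a & f w = u].

(* Main.v *)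
Require Import Defs.
From mathcomp Require Import all_boot all_order all_algebra.
From mathcomp Require Import complex.
From mathcomp Require Import all_classical all_reals all_analysis.

(** The isomorphism can be written down on generators.  In the crossed product
    write [S1], [S2] for the images of the generators; covariance says
    [w S1 = S2 w] with [w] a self-adjoint unitary.  Then [S1] and
    [S2 w = w S1] again form a Cuntz pair, since multiplying [S2] on the right
    by a unitary does not change its range projection, and this pair already
    generates the crossed product: [w] is recovered from it as the unitary
    which exchanges the two isometries,
    [w = (S2 w) S1^* + S1 (S2 w)^*] ([flip_twist]).

    Conversely, in O_2 the element [u = S2 S1^* + S1 S2^*] is a self-adjoint
    unitary with [u S1 = S2] and [u S2 = S1].  The pair [S1], [S2 u] is a Cuntz
    pair whose members are exchanged by conjugation by [u], so together with
    [u] it gives a covariant representation of (O_2, sigma) in O_2.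

    The universal properties turn these two observations into
    *-homomorphisms O_2 -> B and B -> O_2, and the uniqueness they contain
    shows that both composites are identities, as they fix the generators. *)

Set Implicit Arguments.
Unset Strict Implicit.
Unset Printing Implicit Defensive.

Import GRing.Theory.
Local Open Scope ring_scope.

Section StarAlgebra.
Variables (R : realType) (A : cstarAlgType R).
Implicit Types (x u : A).

Lemma cnorm0 : cnorm (0 : A) = 0.
Proof. by rewrite -(scale0r (0 : A)) cnormZ Normc.normc0 mul0r. Qed.

Lemma star_mul_eq0 x : star x * x = 0 -> x = 0.
Proof.
move=> xx0; apply: cnorm0_eq0; apply/eqP.
by rewrite -[_ == 0](expf_eq0 _ 2) -cnorm_starM xx0 cnorm0.
Qed.

Lemma star_unitary_involution u : unitary_elt u -> u ^+ 2 = 1 -> star u = u.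
Proof. by move=> [uu _] u2; rewrite -[LHS]mulr1 -u2 expr2 mulrA uu mul1r. Qed.

End StarAlgebra.

Section StarHom.
Variables (R : realType) (A B : cstarAlgType R).

Lemma star_homD (f : A -> B) : star_hom f -> {morph f : x y / x + y}.
Proof. by move=> [lf _ _] x y; rewrite -{1}[x]scale1r lf scale1r. Qed.

Lemma star_homM (f : A -> B) : star_hom f -> {morph f : x y / x * y}.
Proof. by case=> _ []. Qed.

Lemma star_hom1 (f : A -> B) : star_hom f -> f 1 = 1.
Proof. by case=> _ []. Qed.

Lemma star_hom_star (f : A -> B) : star_hom f -> {morph f : x / star x}.
Proof. by case. Qed.

End StarHom.

Lemma star_hom_comp (R : realType) (A B D : cstarAlgType R) (g : B -> D) (f : A -> B) :
  star_hom g -> star_hom f -> star_hom (g \o f).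
Proof.
move=> [lg [g1 gM] gs] [lf [f1 fM] fs]; split; last by move=> x /=; rewrite fs gs.
  by move=> c x y /=; rewrite lf lg.
by split=> [|x y] /=; rewrite ?f1 ?g1 ?fM ?gM.
Qed.

Lemma star_hom_conj (R : realType) (A B : cstarAlgType R) (u : B) (f : A -> B) :
  unitary_elt u -> star_hom f -> star_hom (fun a => u * f a * star u).
Proof.
move=> [uu uU] [lf [f1 fM] fs]; split.
- by move=> c x y; rewrite lf mulrDr mulrDl -scalerAr -scalerAl.
- split=> [|x y]; first by rewrite f1 mulr1.
  by rewrite fM !mulrA -[u * f x * star u * u]mulrA uu mulr1.
- by move=> x; rewrite fs !starM starK mulrA.
Qed.

Section Uniqueness.
Variables (R : realType) (A B D : cstarAlgType R).

Lemma star_hom_cuntz_pair (f : A -> B) (s1 s2 : A) :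
  star_hom f -> cuntz_pair s1 s2 -> cuntz_pair (f s1) (f s2).
Proof.
move=> hf [i1 i2 s12]; rewrite /cuntz_pair /isometry_elt.
rewrite -!(star_hom_star hf) -!(star_homM hf) -(star_homD hf).
by rewrite i1 i2 s12 (star_hom1 hf).
Qed.

(** Universality, which speaks of prescribed Cuntz pairs, applies here because
    the images of the generators under [f] form one; [f] and [g] are then both
    the unique morphism attached to it.  This is how identities between
    *-homomorphisms get reduced to computations on two elements. *)
Lemma cuntz_star_hom_eq (s1 s2 : A) (f g : A -> B) :
  is_cuntz_algebra s1 s2 -> star_hom f -> star_hom g ->
  f s1 = g s1 -> f s2 = g s2 -> f = g.
Proof.
move=> [s12 univ] hf hg fg1 fg2.
have [h [_ h_uniq]] := univ _ _ _ (star_hom_cuntz_pair hf s12).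
by rewrite -(h_uniq f) // -(h_uniq g).
Qed.

(** As for Cuntz algebras: [f] pushes the canonical covariant pair forward to
    a covariant pair in [D], and [f] and [g] both integrate it. *)
Lemma crossed_star_hom_eq (sigma : A -> A) (iota : A -> B) (w : B)
    (f g : B -> D) :
  is_crossed_product_Z2 sigma iota w -> star_hom f -> star_hom g ->
  (forall a, f (iota a) = g (iota a)) -> f w = g w -> f = g.
Proof.
move=> [[hi [ww wW] w2 cov] univ] hf hg fgi fgw.
have fcov : covariant_pair sigma (f \o iota) (f w).
  split; first exact: star_hom_comp.
  - by split; rewrite -(star_hom_star hf) -(star_homM hf) ?ww ?wW (star_hom1 hf).
  - by rewrite expr2 -(star_homM hf) -expr2 w2 (star_hom1 hf).
  - by move=> a /=; rewrite -(star_hom_star hf) -!(star_homM hf) cov.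
have [h [_ h_uniq]] := univ _ _ _ fcov.
rewrite -(h_uniq f); last by split.
by apply: h_uniq; split=> // a; rewrite /= fgi.
Qed.

End Uniqueness.

Section CuntzPair.
Variables (R : realType) (A : cstarAlgType R).
Implicit Types (s t u : A).

(** Multiplying [1 = s s^* + t t^*] by [t^*] and [t] leaves
    [(s^* t)^* (s^* t) = 0], and the C*-identity does the rest. *)
Lemma cuntz_pair_orth s t : cuntz_pair s t -> star s * t = 0.
Proof.
move=> [_ it st]; apply: star_mul_eq0; rewrite starM starK.
have : star t * (s * star s + t * star t) * t = 1 by rewrite st mulr1.
rewrite mulrDr mulrDl !mulrA it mul1r it => /eqP.
by rewrite -subr_eq0 addrK => /eqP.
Qed.

Lemma cuntz_pairC s t : cuntz_pair s t -> cuntz_pair t s.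
Proof. by case=> is_ it st; split=> //; rewrite addrC. Qed.

(** The range projection of [t u] is [t u u^* t^*], where the unitary cancels. *)
Lemma cuntz_pair_twist s t u :
  cuntz_pair s t -> unitary_elt u -> cuntz_pair s (t * u).
Proof.
move=> [is_ it st] [uu uU]; split=> //.
  by rewrite /isometry_elt starM mulrA -(mulrA (star u)) it mulr1.
by rewrite starM mulrA -(mulrA t) uU mulr1.
Qed.

Definition flip s t : A := t * star s + s * star t.

Lemma star_flip s t : star (flip s t) = flip s t.
Proof. by rewrite /flip starD !starM !starK addrC. Qed.

Lemma flip_mull s t : cuntz_pair s t -> flip s t * s = t.
Proof.
move=> st; have [is_ _ _] := st.
by rewrite /flip mulrDl -!mulrA is_ (cuntz_pair_orth (cuntz_pairC st)) mulr0 addr0 mulr1.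
Qed.

Lemma flip_mulr s t : cuntz_pair s t -> flip s t * t = s.
Proof.
by move=> st; rewrite /flip addrC; apply: flip_mull; apply: cuntz_pairC.
Qed.

Lemma flip_sqr s t : cuntz_pair s t -> flip s t * flip s t = 1.
Proof.
move=> st; have [_ _ e] := st.
by rewrite {2}/flip mulrDr !mulrA flip_mull // flip_mulr // addrC.
Qed.

Lemma flip_unitary s t : cuntz_pair s t -> unitary_elt (flip s t).
Proof. by move=> st; rewrite /unitary_elt star_flip flip_sqr. Qed.

(** Since [u s = t u] and [u] is an involution, also [u t = s u]; hence the two
    terms of the flip are [u s s^*] and [u t t^*]. *)
Lemma flip_twist s t u :
  cuntz_pair s t -> unitary_elt u -> star u = u -> u * s = t * u ->
  flip s (t * u) = u.
Proof.
move=> [_ _ st] [uu _] us ust.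
have uut : u * t = s * u.
  by rewrite -[s in RHS]mul1r -uu us -(mulrA u u s) ust -!mulrA -{3}us uu mulr1.
by rewrite /flip starM us mulrA -uut -ust -!mulrA -mulrDr st mulr1.
Qed.

End CuntzPair.

Theorem theorem2p1 (R : realType) (O2 : cstarAlgType R) (S1 S2 : O2)
    (hO2 : is_cuntz_algebra S1 S2)
    (sigma : O2 -> O2) (hsigma : order_two_automorphism sigma)
    (hsigma1 : sigma S1 = S2)
    (B : cstarAlgType R) (iota : O2 -> B) (w : B)
    (hB : is_crossed_product_Z2 sigma iota w) :
  star_isomorphic B O2.
Proof.
have [hS univO] := hO2.
have [[hi hw w2 cov] univB] := hB.
have [hs sigmaK _] := hsigma.
have hsigma2 : sigma S2 = S1 by rewrite -hsigma1 sigmaK.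
have ws : star w = w by exact: star_unitary_involution.
have hiS := star_hom_cuntz_pair hi hS.
have wS : w * iota S1 = iota S2 * w.
  by rewrite -hsigma1 -cov -mulrA (proj1 hw) mulr1.
pose u := flip S1 S2; have hu : unitary_elt u := flip_unitary hS.
(* The morphisms out of O_2 given by the two twisted pairs: [f] lands in the
   crossed product, [p] in O_2 itself as the covariant partner of [u]. *)
have [f [[hf f1 f2] _]] := univO _ _ _ (cuntz_pair_twist hiS hw).
have [p [[hp p1 p2] _]] := univO _ _ _ (cuntz_pair_twist hS hu).
have pcov : covariant_pair sigma p u.
  split=> //; first by rewrite expr2 flip_sqr.
  (* Conjugating by [u] swaps [S1 = p S1] and [S2 u = p S2]: indeed
     [u S1 u = S2 u] and [u (S2 u) u = S1]. *)
  suff conj_p : (fun a => u * p a * star u) = p \o sigma.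
    by move=> a; exact: (congr1 (@^~ a) conj_p).
  apply: (cuntz_star_hom_eq hO2).
  - exact: star_hom_conj.
  - exact: star_hom_comp.
  - by rewrite /= hsigma1 p1 p2 flip_mull // star_flip.
  - rewrite /= hsigma2 p1 p2 mulrA flip_mulr // -mulrA.
    by rewrite (proj2 hu) mulr1.
have [g [[hg gi gw] _]] := univB _ _ _ pcov.
have fu : f u = w.
  rewrite /u /flip (star_homD hf) !(star_homM hf) !(star_hom_star hf) f1 f2.
  exact: flip_twist.
have fp : f \o p = iota.
  apply: (cuntz_star_hom_eq hO2) => //=; first exact: star_hom_comp.
    by rewrite p1 f1.
  by rewrite p2 (star_homM hf) fu f2 -mulrA -{1}ws (proj1 hw) mulr1.
have gf : g \o f = id.
  apply: (cuntz_star_hom_eq hO2) => //=; first exact: star_hom_comp.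
    by rewrite f1 gi p1.
  by rewrite f2 (star_homM hg) gi gw p2 -mulrA flip_sqr ?mulr1.
have fg : f \o g = id.
  apply: (crossed_star_hom_eq hB) => //=; first exact: star_hom_comp.
    by move=> a; rewrite gi -fp.
  by rewrite gw fu.
exists g; split=> //; exists f => x.
- exact: (congr1 (@^~ x) fg).
- exact: (congr1 (@^~ x) gf).
Qed.
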